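(* Consider a $[pqrs]$ random walk on $(-\infty,\infty)$ (no absorbing barriers), started in $i_0\in\mathbb{Z}$. For every $n\in\mathbb{Z}$ the probability of absorption in state $n$ is $s\,x_n$, where the expected number of visits $x_n$ is $$x_n=\begin{cases}\zeta\,\xi_1^{n-i_0} & (n\le i_0),\\ \zeta\,\xi_2^{n-i_0} & (n\ge i_0).\end{cases}$$
   Context: Let $p,q,s>0$, $r\ge0$ with $p+q+r+s=1$. A $[pqrs]$ random walk on $(-\infty,\infty)$, i.e. on $\mathbb{Z}$: in each state $n$, at each time unit the walk moves to $n+1$ with probability $p$, moves to $n-1$ with probability $q$, stays in $n$ for a time unit with probability $r$, and with probability $s$ is absorbed in the current state $n$ (the process terminates there). $x_n$ denotes the expected number of visits to state $n$ when starting in $i_0$ (time $0$ counted). Notation: $$\xi_1=\frac{(1-r)+\sqrt{(1-r)^2-4pq}}{2q},\quad \xi_2=\frac{(1-r)-\sqrt{(1-r)^2-4pq}}{2q},\quad \zeta=\left[(1-r)^2-4pq\right]^{-1/2};$$ one has $\xi_1>1>\xi_2>0$. *)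

(* Defs.v *)
(* MathComp-Analysis. *)
From HB Require Import structures.
From mathcomp Require Import all_boot all_order all_algebra.
From mathcomp Require Import all_classical all_reals all_analysis.
Import Order.TTheory GRing.Theory Num.Theory.

Set Implicit Arguments.
Unset Strict Implicit.
Unset Printing Implicit Defensive.

Local Open Scope classical_set_scope.
Local Open Scope ring_scope.

(* Absorption may happen in any site, and a terminated walk makes no further
   visits; a state therefore records whether the walk is still running. *)
Inductive walk_state :=
  | Running of int
  | Absorbed of int.

Definition walk_state_code (a : walk_state) : int + int :=
  match a with Running n => inl n | Absorbed n => inr n end.

Definition walk_state_decode (c : int + int) : walk_state :=
  match c with inl n => Running n | inr n => Absorbed n end.

Lemma walk_state_codeK : cancel walk_state_code walk_state_decode.
Proof. by case. Qed.

HB.instance Definition _ := Countable.copy walk_state (can_type walk_state_codeK).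
HB.instance Definition _ := isPointed.Build walk_state (Running 0).
HB.instance Definition _ := @isMeasurable.Build default_measure_display
  walk_state discrete_measurable discrete_measurable0
  discrete_measurableC discrete_measurableU.

Section MarkovChain.
Context d d' (T : measurableType d) (S : measurableType d') (R : realType).

(* Time-homogeneous Markov chain started in x0, for a countable state space S
   with its discrete sigma-algebra. The last clause is
   P (X_(t+1) = a_(t+1) | X_0 = a_0, ..., X_t = a_t) = K a_t a_(t+1)
   multiplied by the probability of the conditioning event. *)
Definition markov_chain (P : probability T R) (K : S -> S -> R) (x0 : S)
    (X : nat -> {RV P >-> S}) : Prop :=
  P (X 0%N @^-1` [set x0]) = 1%E /\
  forall (t : nat) (a : nat -> S),
    P [set w | forall i, (i <= t.+1)%N -> X i w = a i] =
    (P [set w | forall i, (i <= t)%N -> X i w = a i] * (K (a t) (a t.+1))%:E)%E.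

End MarkovChain.

Section Walk.
Context (R : realType).

Definition pqrs_step (p q r s : R) (a b : walk_state) : R :=
  match a, b with
  | Running m, Running n =>
      if n == m + 1 then p
      else if n == m - 1 then q
      else if n == m then r
      else 0
  | Running m, Absorbed n => if n == m then s else 0
  | Absorbed _, Running _ => 0
  | Absorbed m, Absorbed n => if n == m then 1 else 0
  end.

Definition pqrs_walk d (T : measurableType d) (P : probability T R)
    (p q r s : R) (i0 : int) (X : nat -> {RV P >-> walk_state}) : Prop :=
  markov_chain (pqrs_step p q r s) (Running i0) X.

(* The library's 'E_P is for real-valued functions; the number of visits is
   a priori only extended-real-valued. *)
Definition expected_visits d (T : measurableType d) (P : probability T R)
    (X : nat -> {RV P >-> walk_state}) (n : int) : \bar R :=
  (\int[P]_w \sum_(0 <= t <oo) (\1_(X t @^-1` [set Running n]) w)%:E)%E.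

Definition absorption_probability d (T : measurableType d)
    (P : probability T R) (X : nat -> {RV P >-> walk_state}) (n : int)
    : \bar R :=
  P [set w | exists t, X t w = Absorbed n].

Definition xi1 (p q r : R) : R :=
  ((1 - r) + Num.sqrt ((1 - r) ^+ 2 - 4 * p * q)) / (2 * q).

Definition xi2 (p q r : R) : R :=
  ((1 - r) - Num.sqrt ((1 - r) ^+ 2 - 4 * p * q)) / (2 * q).

Definition zeta (p q r : R) : R :=
  ((1 - r) ^+ 2 - 4 * p * q) `^ (- 2^-1).

End Walk.

(* Main.v *)
Require Import Defs.
From mathcomp Require Import all_boot all_order all_algebra.
From mathcomp Require Import all_classical all_reals all_analysis.
From mathcomp Require Import ring lra zify.
From mathcomp Require Import measurable_realfun.
Import Order.TTheory GRing.Theory Num.Theory numFieldNormedType.Exports.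
Local Open Scope ring_scope.

Set Implicit Arguments.
Unset Strict Implicit.
Unset Printing Implicit Defensive.

(** Write u_t n for the probability that the walk is running in n at time t.
The expected number of visits to n is the sum over t of u_t n, and by the
Markov property u_0 is the unit mass at i0 and u_(t+1) = A u_t
([occupation_step]), where A = [walk_op] is the transfer operator
(A f) n = p f(n-1) + q f(n+1) + r f n.

The series is summed without generating functions and without knowing
beforehand that it converges.  The claimed value, [green], is a bounded
solution g of the balance equation g = delta_i0 + A g ([green_balance]): away
from i0 this says that xi1 and xi2 are the roots of
q x^2 - (1 - r) x + p = 0, and at i0 it is what fixes the constant zeta.
Hence g minus the N-th partial sum of the u_t satisfies e_(N+1) = A e_N with
e_0 = g.  Since p + q + r = 1 - s, the operator A contracts the sup norm by the
factor 1 - s < 1, so the remainder is at most (1 - s)^N zeta and tends to 0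
([occupation_series]).  That g is bounded rests on
0 < xi2 < 1 < xi1 ([green_bounds]).

For the absorption probability, one step of the chain gives
P (X_(t+1) = Absorbed n) = P (X_t = Absorbed n) + s u_t n, so the probability of
sitting in Absorbed n at time N is s times the N-th partial sum
([absorption_by_time]); as an absorbed walk almost surely stays where it is,
these probabilities converge to the probability of ever being absorbed in n
([absorption_probability_cvg]).

The chain is specified by the probabilities of complete trajectories, so the
one-step relations above need the Markov property for the pair (X_t, X_(t+1))
alone.  It is obtained in [markov_step] by summing out the earlier coordinates
one at a time, each over the countable state space. *)

(** * The balance equation *)

Definition pqrs_params (R : realType) (p q r s : R) : Prop :=
  [/\ 0 < p, 0 < q, 0 <= r, 0 < s & p + q + r + s = 1].

Definition walk_op (R : realType) (p q r : R) (f : int -> R) (n : int) : R :=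
  p * f (n - 1) + q * f (n + 1) + r * f n.

(** The Green function of the walk: the common closed form of the two cases of
the expected number of visits. *)
Definition green (R : realType) (p q r : R) (i0 n : int) : R :=
  zeta p q r * (if n <= i0 then xi1 p q r else xi2 p q r) ^ (n - i0).

(** With 1 - r = p + q + s the discriminant is (p - q)^2 + s (s + 2 (p + q)). *)
Lemma discr_gt0 (R : realType) (p q r s : R) : pqrs_params p q r s ->
  0 < (1 - r) ^+ 2 - 4 * p * q.
Proof.
move=> [hp hq hr hs hsum].
rewrite (_ : 1 - r = p + q + s); last by lra.
rewrite [ltRHS](_ : _ = s * (s + 2 * (p + q)) + (p - q) ^+ 2); last by ring.
by rewrite ltr_wpDr ?sqr_ge0// mulr_gt0//; lra.
Qed.

(** The lower bound places 1 strictly between the two roots, the upper bound makes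
the smaller root positive.  Squared, the bounds differ from the discriminant by
4 q s and 4 p q respectively. *)
Lemma sqrt_discr_bounds (R : realType) (p q r s : R) : pqrs_params p q r s ->
  `|q - p - s| < Num.sqrt ((1 - r) ^+ 2 - 4 * p * q) < 1 - r.
Proof.
move=> par; have [hp hq hr hs hsum] := par.
set S := Num.sqrt _.
have S2 : S ^+ 2 = (1 - r) ^+ 2 - 4 * p * q.
  by rewrite sqr_sqrtr// ltW// (discr_gt0 par).
have S0 : 0 <= S by exact: sqrtr_ge0.
have r1 : 1 - r = p + q + s by lra.
have pq0 : 0 < p * q by exact: mulr_gt0.
have qs0 : 0 < q * s by exact: mulr_gt0.
apply/andP; split.
  rewrite -(@ltr_pXn2r _ 2)// ?nnegrE// S2 r1 real_normK ?num_real//.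
  by rewrite -subr_gt0 [ltRHS](_ : _ = 4 * (q * s)); [lra|ring].
rewrite -(@ltr_pXn2r _ 2)// ?nnegrE// ?S2; [|lra].
by rewrite -mulrA ltrBlDr ltrDl; lra.
Qed.

Lemma xi_bounds (R : realType) (p q r s : R) : pqrs_params p q r s ->
  [/\ 0 < xi2 p q r, xi2 p q r < 1 & 1 < xi1 p q r].
Proof.
move=> par; have [hp hq hr hs hsum] := par.
have /andP[] := sqrt_discr_bounds par.
rewrite ltr_norml => /andP[h1 h2] h3.
by split; rewrite ?divr_gt0 ?ltr_pdivrMr ?ltr_pdivlMr//; lra.
Qed.

Lemma xi_root (R : realType) (p q r e : R) : q != 0 ->
  e ^+ 2 = (1 - r) ^+ 2 - 4 * p * q ->
  let x := ((1 - r) + e) / (2 * q) in q * x ^+ 2 = (1 - r) * x - p.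
Proof.
move=> q0 e2 /=; apply: (@mulIf _ (4 * q)); first by rewrite mulf_neq0.
transitivity ((1 - r + e) ^+ 2); first by field.
transitivity (2 * (1 - r) * (1 - r + e) - 4 * p * q); last by field.
by rewrite sqrrD e2; ring.
Qed.

(** The discriminant is (q (xi1 - xi2))^2; this form makes the balance at the
starting point a rational identity in the two roots. *)
Lemma zetaE (R : realType) (p q r s : R) : pqrs_params p q r s ->
  zeta p q r = (q * (xi1 p q r - xi2 p q r))^-1.
Proof.
move=> par; have [hp hq hr hs hsum] := par.
rewrite /zeta powRN powR12_sqrt ?(ltW (discr_gt0 par))//; congr (_^-1).
by rewrite /xi1 /xi2; field; rewrite gt_eqF.
Qed.

Lemma green_bounds (R : realType) (p q r s : R) (i0 n : int) :
  pqrs_params p q r s -> 0 <= green p q r i0 n <= zeta p q r.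
Proof.
move=> par; have [hp hq hr hs hsum] := par.
have [x2 x21 x1] := xi_bounds par.
have z0 : 0 < zeta p q r.
  by rewrite (zetaE par) invr_gt0 mulr_gt0//; lra.
rewrite /green; apply/andP; split.
  by rewrite mulr_ge0 ?(ltW z0)// exprz_ge0//; case: ifP => _; lra.
rewrite (ler_piMr (ltW z0))//; case: ifP => [le|/negbT].
  have -> : n - i0 = - (`|n - i0|%N : int) by lia.
  by rewrite -exprnN invf_le1 ?exprn_gt0 ?exprn_ege1//; lra.
rewrite -ltNge => lt.
have -> : n - i0 = (`|n - i0|%N : int) by lia.
by rewrite -exprnP exprn_ile1// ltW.
Qed.

(** Dividing q x^2 - (1 - r) x + p = 0 by x turns a root into a fixed point of
the transfer operator. *)
Lemma expz_balance (R : realType) (p q r x : R) (m : int) : x != 0 ->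
  q * x ^+ 2 = (1 - r) * x - p ->
  x ^ m = walk_op p q r (fun n => x ^ n) m.
Proof.
move=> x0 xr; rewrite /walk_op !expfzDr// expr1z.
have -> : p = (1 - r) * x - q * x ^+ 2 by rewrite xr; ring.
have -> : x ^ (-1) = x^-1 by [].
by field.
Qed.

(** Off the starting point, n - 1, n and n + 1 lie on the same branch, whose base
is a root.  At i0 the two branches meet, and the defect
zeta (1 - r - p / xi1 - q xi2) equals zeta q (xi1 - xi2) = 1. *)
Lemma green_balance (R : realType) (p q r s : R) (i0 n : int) :
  pqrs_params p q r s ->
  green p q r i0 n = (n == i0)%:R + walk_op p q r (green p q r i0) n.
Proof.
move=> par; have [hp hq hr hs hsum] := par.
have [x2 x21 x1] := xi_bounds par.
have q0 : q != 0 by rewrite gt_eqF.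
have sq : Num.sqrt ((1 - r) ^+ 2 - 4 * p * q) ^+ 2 = (1 - r) ^+ 2 - 4 * p * q.
  by rewrite sqr_sqrtr// ltW// (discr_gt0 par).
have root1 := xi_root q0 sq.
have root2 := xi_root q0 (etrans (sqrrN _) sq).
rewrite /= -/(xi1 p q r) in root1.
rewrite /= -/(xi2 p q r) in root2.
have n1 : xi1 p q r != 0 by rewrite gt_eqF//; lra.
have n2 : xi2 p q r != 0 by rewrite gt_eqF.
have gL k : k <= i0 -> green p q r i0 k = zeta p q r * xi1 p q r ^ (k - i0).
  by rewrite /green => ->.
have gR k : i0 <= k -> green p q r i0 k = zeta p q r * xi2 p q r ^ (k - i0).
  rewrite /green; case: ifP => // ki ik.
  by have -> : k - i0 = 0 by lia.
case: (ltgtP n i0) => [lt|gt|->] /=.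
- rewrite add0r /walk_op !gL; [|lia..].
  rewrite [in LHS](expz_balance _ _ root1)// /walk_op.
  by rewrite (addrAC n 1) (addrAC n (-1)) !mulrDr !(mulrCA (zeta p q r)).
- rewrite add0r /walk_op !gR; [|lia..].
  rewrite [in LHS](expz_balance _ _ root2)// /walk_op.
  by rewrite (addrAC n 1) (addrAC n (-1)) !mulrDr !(mulrCA (zeta p q r)).
rewrite /walk_op (gL i0)// (gL (i0 - 1)); last by lia.
rewrite (gR (i0 + 1)); last by lia.
rewrite subrr (addrAC i0) (addrAC i0 1) subrr !add0r expr0z expr1z.
have -> : xi1 p q r ^ (-1) = (xi1 p q r)^-1 by [].
rewrite (zetaE par); move: root1 n1 x1 x21.
move: (xi1 p q r) (xi2 p q r) => a b root1 a0 a1 b1.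
(* The root equation of xi1 eliminates p and leaves an identity in a, b, q, r. *)
have -> : p = (1 - r) * a - q * a ^+ 2 by rewrite root1; ring.
field.
by rewrite a0 q0 gt_eqF// subr_gt0; lra.
Qed.

Local Open Scope classical_set_scope.

(** The remainder of the series evolves under the transfer operator, which
shrinks the sup norm by p + q + r = 1 - s. *)
Lemma occupation_series (R : realType) (p q r s : R) (u : nat -> int -> R)
  (i0 n : int) : pqrs_params p q r s ->
  (forall m, u 0 m = (m == i0)%:R) ->
  (forall t m, u t.+1 m = walk_op p q r (u t) m) ->
  (fun N => \sum_(0 <= t < N) u t n) @ \oo --> green p q r i0 n.
Proof.
move=> par u0 uS; have [hp hq hr hs hsum] := par.
pose e N m := green p q r i0 m - \sum_(0 <= t < N) u t m.
have eS N m : e N.+1 m = walk_op p q r (e N) m.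
  rewrite {1}/e big_nat_recl// u0 (green_balance _ _ par).
  under eq_bigr do rewrite uS.
  rewrite /walk_op /e !big_split /= -!mulr_sumr; ring.
have eb N m : `|e N m| <= (1 - s) ^+ N * zeta p q r.
  elim: N m => [|N IH] m.
    rewrite /e big_geq// subr0 expr0 mul1r.
    by have /andP[g0 g1] := green_bounds i0 m par; rewrite ger0_norm.
  rewrite eS /walk_op exprS -mulrA.
  rewrite (_ : 1 - s = p + q + r) ?mulrDl; last lra.
  have step (c : R) k : 0 <= c ->
      `|c * e N k| <= c * ((p + q + r) ^+ N * zeta p q r).
    by move=> c0; rewrite normrM (ger0_norm c0) ler_wpM2l//
      (_ : p + q + r = 1 - s) ?IH//; lra.
  apply: le_trans (ler_normD _ _) _; apply: lerD; last exact: step.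
  by apply: le_trans (ler_normD _ _) _; apply: lerD; apply: step; apply: ltW.
have e0 : e N n @[N --> \oo] --> (0 : R).
  apply/norm_cvg0P.
  apply: (@squeeze_cvgr _ _ _ _ (cst 0) (fun N => (1 - s) ^+ N * zeta p q r)).
  - by near=> N; rewrite normr_ge0 eb.
  - exact: cvg_cst.
  - rewrite -[X in _ --> X](mul0r (zeta p q r)); apply: cvgMl.
    by apply: cvg_expr; rewrite ger0_norm; lra.
have -> : (fun N => \sum_(0 <= t < N) u t n) =
    (fun N => green p q r i0 n - e N n).
  by apply/funext => N; rewrite /e subKr.
rewrite -[X in _ --> X]subr0; apply: cvgB => //; exact: cvg_cst.
Unshelve. all: by end_near. Qed.

(** * Marginals of a Markov chain *)

(** Conditioning on a countably valued observable: a proportionality that holds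
on every fiber holds globally. *)
Lemma eq_measure_fibers (R : realType) (d : measure_display)
  (T : measurableType d) (mu : {measure set T -> \bar R}) (C : countType)
  (f : T -> C) (A B : set T) (k : R) :
  (forall c, measurable (f @^-1` [set c])) -> measurable A -> measurable B ->
  (forall c,
    mu (A `&` f @^-1` [set c]) = (k%:E * mu (B `&` f @^-1` [set c]))%E) ->
  mu A = (k%:E * mu B)%E.
Proof.
move=> mf mA mB AB.
have fib i : (exists c, (pickle \o f) @^-1` [set i] = f @^-1` [set c])
    \/ (pickle \o f) @^-1` [set i] = set0.
  have [[w fw]|N] := pselect (exists w, pickle (f w) = i).
    left; exists (f w); apply/seteqP; split=> x /=; rewrite -fw; last by move->.
    exact: (pcan_inj pickleK).
  by right; apply/seteqP; split=> // x /= fx; apply: N; exists x.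
have mfib i : measurable ((pickle \o f) @^-1` [set i]).
  by have [[c ->]|->] := fib i.
(* Additivity is available along nat, so the fibers are indexed by the codes of
   the values of f; a number that codes no value contributes nothing. *)
have split_nat D : measurable D ->
    mu D = (\sum_(i <oo) mu (D `&` (pickle \o f) @^-1` [set i]))%E.
  move=> mD; rewrite -measure_semi_bigcup; first last.
  - by apply: bigcupT_measurable => i; exact: measurableI.
  - by move=> i j _ _ [w [[_ /= <-] [_ /= <-]]].
  - by move=> i; exact: measurableI.
  congr (mu _); apply/seteqP; split=> w /=; last by case=> i _ [].
  by move=> Dw; exists (pickle (f w)).
rewrite (split_nat A)// (split_nat B)// -nneseriesZl//.
apply: eq_eseriesr => i _; have [[c ->]|->] := fib i; first exact: AB.
by rewrite !setI0 measure0 mule0.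
Qed.

Lemma measurable_state_event (R : realType) (d : measure_display)
  (T : measurableType d) (P : probability T R) (Y : {RV P >-> walk_state})
  (D : set walk_state) : measurable (Y @^-1` D).
Proof. exact: measurable_funPTI. Qed.

(** The Markov property seen only through two consecutive times.  The events
constraining the times k, ..., t satisfy it for k = 0 by definition; summing over
the value at time k passes from k to k + 1, until k = t. *)
Lemma markov_step (R : realType) (d : measure_display)
  (T : measurableType d) (P : probability T R)
  (K : walk_state -> walk_state -> R) (x0 : walk_state)
  (X : nat -> {RV P >-> walk_state}) (t : nat) (a b : walk_state) :
  markov_chain K x0 X ->
  P (X t @^-1` [set a] `&` X t.+1 @^-1` [set b])
    = ((K a b)%:E * P (X t @^-1` [set a]))%E.
Proof.
move=> [_ chainX].
pose cyl k t' (c : nat -> walk_state) :=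
  [set w | forall i, (k <= i <= t')%N -> X i w = c i].
have mcyl k t' c : measurable (cyl k t' c).
  have -> : cyl k t' c = \bigcap_i [set w | (k <= i <= t')%N -> X i w = c i].
    by apply/seteqP; split=> w /= H i *; exact: H.
  apply: bigcapT_measurable => i; have [_|_] := boolP (k <= i <= t')%N.
    rewrite [X in measurable X](_ : _ = X i @^-1` [set c i]).
      exact: measurable_state_event.
    by apply/seteqP; split=> w /= H; [exact: H | move=> _].
  by rewrite [X in measurable X](_ : _ = setT)//; apply/seteqP; split.
have marg k c : (k <= t)%N ->
    P (cyl k t.+1 c) = ((K (c t) (c t.+1))%:E * P (cyl k t c))%E.
  elim: k c => [|k IH] c kt.
    rewrite muleC; exact: chainX.
  have fibk t' z : (k < t')%N -> cyl k.+1 t' c `&` X k @^-1` [set z] =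
      cyl k t' (fun i => if i == k then z else c i).
    move=> kt'; apply/seteqP; split=> w /=.
      move=> [H Xk] i ik; case: eqVneq => [->//|ne].
      by apply: H; lia.
    move=> H; split=> [i ik|].
      by rewrite H; [case: eqVneq => // ?; lia | lia].
    by rewrite H ?eqxx//; lia.
  apply: (@eq_measure_fibers _ _ _ _ _ (X k)) => // [z|z].
    exact: measurable_state_event.
  rewrite !fibk//; last exact: ltnW.
  have := IH (fun i => if i == k then z else c i) (ltnW kt).
  by rewrite !gtn_eqF// ltnW.
pose c i := if i == t then a else b.
have /= := marg t c (leqnn t); rewrite /c eqxx gtn_eqF// => E.
rewrite [X in P X](_ : _ = cyl t t.+1 c); last first.
  apply/seteqP; split=> w /=.
    move=> [Xa Xb] i ti; rewrite /c; case: eqVneq => [->//|?].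
    by have -> : i = t.+1 by lia.
  by move=> H; rewrite !H /c ?eqxx ?gtn_eqF//; lia.
rewrite E; congr (_ * P _)%E; apply/seteqP; split=> w /=.
  by move=> H; rewrite H ?eqxx//; lia.
by move=> Xa i ti; have -> : i = t by [lia]; rewrite eqxx.
Qed.

Lemma measure_split_seq (R : realType) (d : measure_display)
  (T : measurableType d) (P : probability T R) (Y : {RV P >-> walk_state})
  (B : set T) (l : seq walk_state) : measurable B -> uniq l ->
  P B = (\sum_(a <- l) P (B `&` Y @^-1` [set a])
         + P (B `&` Y @^-1` [set c | c \notin l]))%E.
Proof.
move=> mB; elim: l => [_|x l IH /= /andP[xl ul]].
  by rewrite big_nil add0e; congr (P _); apply/seteqP; split=> w /=; [|case].
rewrite (IH ul) big_cons [in RHS](addeC (P _)) -addeA; congr (_ + _)%E.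
have mBl : measurable (B `&` Y @^-1` [set c | c \notin l]).
  by apply: measurableI => //; exact: measurable_state_event.
rewrite addeC (measureDI _ mBl (measurable_state_event Y [set x])).
congr (P _ + P _)%E; apply/seteqP; split=> w /=; rewrite ?inE ?negb_or.
- by move=> [[Bw Yl] /eqP Yx]; split=> //; apply/andP.
- by move=> [Bw /andP[/eqP Yx Yl]].
- by move=> [[Bw _] Yx].
- by move=> [Bw Yx]; rewrite Yx.
Qed.

(** The forward equation at a state with finitely many predecessors.  Arriving in
b from any given other state is a null event, and by [eq_measure_fibers] with
factor 0 so is the union of these events over the countable state space. *)
Lemma markov_forward (R : realType) (d : measure_display)
  (T : measurableType d) (P : probability T R)
  (K : walk_state -> walk_state -> R) (x0 : walk_state)
  (X : nat -> {RV P >-> walk_state}) (t : nat) (b : walk_state)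
  (l : seq walk_state) :
  markov_chain K x0 X -> uniq l -> (forall a, a \notin l -> K a b = 0) ->
  P (X t.+1 @^-1` [set b])
    = (\sum_(a <- l) (K a b)%:E * P (X t @^-1` [set a]))%E.
Proof.
move=> chainX ul Kl.
have mE := measurable_state_event (X t.+1) [set b].
rewrite (measure_split_seq (X t) mE ul).
rewrite [X in (_ + X)%E](_ : _ = 0%E) ?adde0.
  by apply: eq_bigr => a _; rewrite setIC (markov_step _ _ _ chainX).
have mR := measurableI _ _ mE
  (measurable_state_event (X t) [set c | c \notin l]).
rewrite (@eq_measure_fibers _ _ _ _ _ (X t) _ setT 0) ?mul0e// => c.
  exact: measurable_state_event.
rewrite mul0e; have [cl|cl] := boolP (c \in l).
  rewrite (_ : _ `&` _ = set0) ?measure0//.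
  by apply/seteqP; split=> w //= [[_ +] cE]; rewrite cE cl.
rewrite (_ : _ `&` _ = X t @^-1` [set c] `&` X t.+1 @^-1` [set b]).
  by have := markov_step t c b chainX; rewrite (Kl c cl) mul0e.
by apply/seteqP; split=> w /=; [case=> -[] | case=> -> ->].
Qed.

Lemma markov_init (R : realType) (d : measure_display)
  (T : measurableType d) (P : probability T R)
  (K : walk_state -> walk_state -> R) (x0 : walk_state)
  (X : nat -> {RV P >-> walk_state}) (b : walk_state) :
  markov_chain K x0 X -> P (X 0 @^-1` [set b]) = (b == x0)%:R%:E.
Proof.
move=> [X0 _]; case: eqVneq => [->//|bx].
have mV c := measurable_state_event (X 0) [set c].
apply: (@subset_measure0 _ _ _ P _ (~` (X 0 @^-1` [set x0]))) => //.
- exact: measurableC.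
- by move=> w /= -> /eqP; exact/negP.
- by have := probability_setC P (mV x0); rewrite X0 subee.
Qed.

(** * Occupation and absorption probabilities *)

Lemma occupation_step (R : realType) (p q r s : R) (d : measure_display)
  (T : measurableType d) (P : probability T R) (i0 : int)
  (X : nat -> {RV P >-> walk_state}) (t : nat) (n : int) :
  pqrs_walk p q r s i0 X ->
  fine (P (X t.+1 @^-1` [set Running n]))
    = walk_op p q r (fun m => fine (P (X t @^-1` [set Running m]))) n.
Proof.
move=> hX; pose l := [:: Running (n - 1); Running (n + 1); Running n].
have runE i j : (Running i == Running j) = (i == j).
  by apply/eqP/eqP => [[]//|->].
rewrite (@markov_forward _ _ _ _ _ _ _ t _ l hX).
- have fP m : P (X t @^-1` [set Running m])
      = (fine (P (X t @^-1` [set Running m])))%:E.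
    by rewrite fineK// fin_num_measure//; exact: measurable_state_event.
  rewrite !big_cons big_nil adde0 /walk_op /=.
  have -> : (n == n - 1 + 1) by lia.
  have -> : (n == n + 1 + 1) = false by lia.
  have -> : (n == n + 1 - 1) by lia.
  have -> : (n == n + 1) = false by lia.
  have -> : (n == n - 1) = false by lia.
  by rewrite eqxx (fP (n - 1)) (fP (n + 1)) (fP n) /= addrA.
- by rewrite /l /= !inE !runE; lia.
- move=> [m|m]; last by [].
  rewrite /l !inE !runE /= => /norP[h1 /norP[h2 h3]].
  by rewrite !ifF//; lia.
Qed.

Lemma absorption_by_time (R : realType) (p q r s : R) (d : measure_display)
  (T : measurableType d) (P : probability T R) (i0 : int)
  (X : nat -> {RV P >-> walk_state}) (N : nat) (n : int) :
  pqrs_walk p q r s i0 X ->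
  P (X N @^-1` [set Absorbed n])
    = (s * \sum_(0 <= t < N) fine (P (X t @^-1` [set Running n])))%:E.
Proof.
move=> hX; elim: N => [|N IH].
  by rewrite big_geq// mulr0 (markov_init _ hX); case: eqP.
rewrite (@markov_forward _ _ _ _ _ _ _ N _ [:: Absorbed n; Running n] hX).
- rewrite big_nat_recr// !big_cons big_nil adde0 /= !eqxx mul1e IH mulrDr EFinD.
  congr (_ + _)%E; rewrite EFinM fineK// fin_num_measure//.
  exact: measurable_state_event.
- by [].
- move=> [m|m] /=; rewrite !inE => /norP[h1 h2]; case: eqP => // nm.
    by rewrite nm eqxx in h2.
  by rewrite nm eqxx in h1.
Qed.

(** The events (X_t = Absorbed n) increase with t only up to null sets, since
nothing prevents a trajectory of probability 0 from leaving an absorbed state.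
They are therefore compared with the events C t of having been in Absorbed n by
time t, which increase in earnest. *)
Lemma absorption_probability_cvg (R : realType) (p q r s : R)
  (d : measure_display) (T : measurableType d) (P : probability T R)
  (i0 : int) (X : nat -> {RV P >-> walk_state}) (n : int) :
  pqrs_walk p q r s i0 X ->
  P (X N @^-1` [set Absorbed n]) @[N --> \oo] --> absorption_probability X n.
Proof.
move=> hX; pose B t := X t @^-1` [set Absorbed n].
pose C t := \bigcup_(i in [set i | (i <= t)%N]) B i.
have mB t : measurable (B t) by exact: measurable_state_event.
have mC t : measurable (C t) by apply: bigcup_measurable => *; exact: mB.
have leave t : P (B t `\` B t.+1) = 0%E.
  rewrite measureD//; last first.
    by rewrite (le_lt_trans (probability_le1 P (mB t)))// ltry.
  rewrite [X in (_ - X)%E](markov_step t _ _ hX) /= eqxx mul1e subee//.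
  exact: fin_num_measure.
have CB t : P (C t `\` B t) = 0%E.
  elim: t => [|t IH].
    rewrite [X in P X](_ : _ = set0) ?measure0//.
    by apply/seteqP; split=> w //= [[i /=]]; rewrite leqn0 => /eqP ->.
  apply: (@subset_measure0 _ _ _ P _ ((C t `\` B t) `|` (B t `\` B t.+1))).
  - exact: measurableD.
  - by apply: measurableU; exact: measurableD.
  - move=> w /= [[i /= it Bi] nB].
    have [Bt|nBt] := pselect (B t w); [by right|left; split=> //].
    exists i => //=; move: it; rewrite leq_eqVlt => /orP[/eqP iE|//].
    by rewrite iE in Bi.
  - by apply: etrans IH; apply: measureU0 (leave t); exact: measurableD.
have PC : (fun t => P (B t)) = P \o C.
  apply/funext => t /=; rewrite (measureDI P (mC t) (mB t)).
  rewrite [X in (X + _)%E]CB add0e.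
  congr (P _); apply/seteqP; split=> w /=; last by case.
  by move=> Bw; split=> //; exists t => /=.
rewrite -/(B _) PC.
have -> : absorption_probability X n = P (\bigcup_t C t).
  congr (P _); apply/seteqP; split=> w /=.
    by move=> [t Xt]; exists t => //; exists t => /=.
  by move=> [t _ [i _ Xi]]; exists i.
apply: nondecreasing_cvg_mu => //; first exact: bigcupT_measurable.
move=> i j ij; apply/subsetPset => w [k /= ki Bk]; exists k => //=.
exact: leq_trans ij.
Qed.

Lemma expected_visitsE (R : realType) (d : measure_display)
  (T : measurableType d) (P : probability T R)
  (X : nat -> {RV P >-> walk_state}) (n : int) :
  expected_visits X n = (\sum_(t <oo) P (X t @^-1` [set Running n]))%E.
Proof.
have mV t := measurable_state_event (X t) [set Running n].
rewrite /expected_visits integral_nneseries//.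
- by apply: eq_eseriesr => t _; rewrite integral_indic// setIT.
- by move=> t; apply/measurable_EFinP; exact: measurable_indic.
Qed.

Theorem theorem5 (R : realType) (p q r s : R)
  (hp : 0 < p) (hq : 0 < q) (hs : 0 < s) (hr : 0 <= r)
  (hsum : p + q + r + s = 1)
  (d : measure_display) (T : measurableType d) (P : probability T R)
  (i0 : int) (X : nat -> {RV P >-> walk_state})
  (hX : pqrs_walk p q r s i0 X) (n : int) :
  absorption_probability X n = (s%:E * expected_visits X n)%E /\
  (n <= i0 -> expected_visits X n = (zeta p q r * xi1 p q r ^ (n - i0))%:E) /\
  (i0 <= n -> expected_visits X n = (zeta p q r * xi2 p q r ^ (n - i0))%:E).
Proof.
have par : pqrs_params p q r s by [].
pose u t m := fine (P (X t @^-1` [set Running m])).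
have u_cvg : (fun N => \sum_(0 <= t < N) u t n) @ \oo --> green p q r i0 n.
  apply: (@occupation_series _ p q r s u) => // [m|t m].
    by rewrite /u (markov_init _ hX).
  exact: occupation_step hX.
have visits : expected_visits X n = (green p q r i0 n)%:E.
  rewrite expected_visitsE; apply/cvg_lim => //.
  rewrite [X in X @ _ --> _](_ : _ =
      EFin \o (fun N => \sum_(0 <= t < N) u t n)); last first.
    apply/funext => N /=; rewrite -sumEFin; apply: eq_bigr => t _.
    by rewrite fineK// fin_num_measure//; exact: measurable_state_event.
  by apply: cvg_EFin => //; near do by [].
split; last split.
- rewrite visits -EFinM.
  rewrite -(cvg_lim _ (absorption_probability_cvg hX))//.
  apply/cvg_lim => //.
  rewrite [X in X @ _ --> _](_ : _ =
      EFin \o (fun N => s * \sum_(0 <= t < N) u t n)); last first.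
    by apply/funext => N; exact: absorption_by_time hX.
  by apply: cvg_EFin; [near do by [] | exact: cvgMr].
- by rewrite visits /green => ->.
(* Both closed forms equal zeta at n = i0. *)
- rewrite visits /green => ni; case: ifP => // ni'.
  by have -> : n - i0 = 0 by lia.
Unshelve. all: by end_near. Qed.
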